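(* Let $\lambda_0,\lambda_1,c_0,c_1\in\mathbb{R}$ and $p_0,p_1\in(0,1)$. Let $\{V(n)\}_{n\in\mathbb{Z}}$ be a sequence of independent random variables such that $V(n)=\lambda_0\xi_n+c_0$ for even $n$ and $V(n)=\lambda_1\xi_n+c_1$ for odd $n$, where $\xi_n$ is a Bernoulli random variable taking the value $1$ with probability $p_0$ (for $n$ even), respectively $p_1$ (for $n$ odd), and the value $0$ otherwise. Let $H_V$ be the discrete Schrödinger operator on $\ell^2(\mathbb{Z})$ given by $(H_V\phi)(n)=\phi(n+1)+\phi(n-1)+V(n)\phi(n)$. Then the almost sure spectrum $\sigma_{as}(H_V)$ consists of at most $4$ closed intervals.
   Context: The spectrum of a bounded operator $H$ is $\sigma(H)=\{E\in\mathbb{R}: H-E \text{ has no bounded inverse}\}$. For this random family there is a deterministic set $\sigma_{as}(H_V)\subset\mathbb{R}$, the almost sure spectrum, such that $\sigma(H_V)=\sigma_{as}(H_V)$ for almost every realization of the potential. *)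

(* Defs.v *)
From HB Require Import structures.
From mathcomp Require Import all_boot all_order all_algebra.
From mathcomp Require Import all_classical all_reals all_analysis.
Set Implicit Arguments. Unset Strict Implicit. Unset Printing Implicit Defensive.
Import Order.TTheory GRing.Theory Num.Theory.
Local Open Scope classical_set_scope.
Local Open Scope ring_scope.

Section Defs.
Variable R : realType.

Definition l2sq (u : int -> R) : \bar R := (\esum_(n in [set: int]) ((u n) ^+ 2)%:E)%E.

Definition in_l2 (u : int -> R) : Prop := (l2sq u < +oo)%E.

Definition schr_shift (V : int -> R) (E : R) (u : int -> R) : int -> R :=
  fun n => u (n + 1)%R + u (n - 1)%R + (V n - E) * u n.

Definition has_bounded_inverse (V : int -> R) (E : R) : Prop :=
  exists G : (int -> R) -> (int -> R),
    [/\ forall u, in_l2 u -> in_l2 (G u),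
        exists C : R, forall u, in_l2 u -> (l2sq (G u) <= C%:E * l2sq u)%E,
        forall u, in_l2 u -> schr_shift V E (G u) = u
      & forall u, in_l2 u -> G (schr_shift V E u) = u].

Definition spectrum (V : int -> R) : set R :=
  [set E : R | ~ has_bounded_inverse V E].

Definition independent_rvs (d : measure_display) (T : measurableType d)
    (P : probability T R) (X : int -> T -> R) : Prop :=
  forall (s : seq int) (B : int -> set R),
    uniq s -> (forall j, measurable (B j)) ->
    P (\big[setI/setT]_(j <- s) (X j @^-1` B j)) =
    (\prod_(j <- s) P (X j @^-1` B j))%E.

End Defs.

(* Main.v *)
(**
  With [a] and [b] ranging over the values of the potential at even and at odd
  sites, the almost sure spectrum is the union of the spectra
  [{E | 0 <= (E - a) (E - b) <= 4}] of the 2-periodic operators.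

  If [E] lies in none of these sets, put [D n = V n - E] and [J = sgn D]. Two
  neighbours with [D] of the same sign satisfy [D n * D (n+1) > 4], and the
  hopping terms between neighbours of opposite signs cancel in
  [<u, J (H - E) u>]. By AM-GM, [J (H - E)] is thus coercive, hence invertible.

  Conversely, almost every realization contains arbitrarily long stretches of
  each 2-periodic pattern, by independence. If [0 <= (E - a) (E - b) <= 4], a
  bounded generalized eigenfunction of the periodic operator, truncated to a
  long stretch, contradicts a bound [|u|^2 <= C |(H - E) u|^2].

  Finally, each of the at most eight bands of the 2-periodic spectra has one of
  the (at most four) values of the potential as an endpoint; bands sharing such
  a point merge into one interval.
*)
Require Import Defs.
From HB Require Import structures.
From mathcomp Require Import all_boot all_order all_algebra.
From mathcomp Require Import all_classical all_reals all_analysis.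
From mathcomp Require Import measurable_realfun finmap ring lra zify.
Set Implicit Arguments. Unset Strict Implicit.
Import Order.TTheory GRing.Theory Num.Theory numFieldNormedType.Exports.
Local Open Scope classical_set_scope.
Local Open Scope ring_scope.

(** * Sums over the integers *)

Local Notation sumZ f := (\esum_(n in [set: int]) (f n)%:E)%E.

Section SumZ.
Context {R : realType}.
Implicit Types (f g : int -> R) (u v : int -> R).
Local Open Scope ereal_scope.

Lemma sumZ_ge0 f : (forall n, 0 <= f n)%R -> 0 <= sumZ f.
Proof. by move=> f0; apply: esum_ge0 => n _; rewrite lee_fin. Qed.

Lemma le_sumZ f g : (forall n, f n <= g n)%R -> sumZ f <= sumZ g.
Proof. by move=> fg; apply: le_esum => n _; rewrite lee_fin. Qed.

Lemma sumZD f g : (forall n, 0 <= f n)%R -> (forall n, 0 <= g n)%R ->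
  sumZ (fun n => f n + g n)%R = sumZ f + sumZ g.
Proof.
by move=> f0 g0; rewrite -esumD => [|n _|n _]; rewrite ?lee_fin.
Qed.

Lemma sumZ_shift f (k : int) : sumZ (fun n => f (n + k)%R) = sumZ f.
Proof.
apply/esym/(@reindex_esum _ _ _ setT setT (fun n : int => n + k)%R (EFin \o f)).
split => //; first by move=> x y _ _ /addIr.
by move=> y _; exists (y - k)%R => //; rewrite subrK.
Qed.

Lemma sumZ_lub f c : (forall s : seq int, uniq s -> \sum_(n <- s) f n <= c)%R ->
  sumZ f <= c%:E.
Proof.
move=> fc; apply: ge_ereal_sup => _ [A [finA _] <-].
rewrite fsbig_finite//= sumEFin lee_fin.
by apply: fc; exact: fset_uniq.
Qed.

Lemma sum_le_sumZ f (s : seq int) : (forall n, 0 <= f n)%R -> uniq s ->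
  (\sum_(n <- s) f n)%R%:E <= sumZ f.
Proof.
move=> f0 us; apply: esum_ge; exists [set` s]; first by split => //; exact: finite_seq.
by rewrite -fsbig_seq//= sumEFin.
Qed.

Lemma sumZ_scale_le (c : R) f : (0 <= c)%R -> (forall n, 0 <= f n)%R ->
  sumZ (fun n => c * f n)%R <= c%:E * sumZ f.
Proof.
move=> c0 f0; apply: ge_ereal_sup => _ [A [finA _] <-].
rewrite fsbig_finite//= sumEFin -mulr_sumr EFinM lee_wpmul2l ?lee_fin//.
by apply: sum_le_sumZ => //; exact: fset_uniq.
Qed.

(* [b - h] is nonnegative and summable, so the telescoping flux [h] contributes
   nothing to the sum although [h] itself is signed. *)
Lemma le_sumZ_flux f g (b h : int -> R) :
  (forall n, 0 <= f n)%R -> (forall n, 0 <= g n)%R ->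
  (forall n, `|h n| <= b n)%R -> sumZ b < +oo ->
  (forall n, f n <= g n + (h n - h (n - 1)))%R -> sumZ f <= sumZ g.
Proof.
move=> f0 g0 hb bfin fgh.
have b0 n : (0 <= b n)%R by apply: le_trans (hb n).
have bh0 n : (0 <= b n - h n)%R by rewrite subr_ge0 (le_trans (ler_norm _)).
have bb : sumZ b \is a fin_num by rewrite ge0_fin_numE// sumZ_ge0.
have [p pE] : exists p : int -> R, forall n, p n = (b n - h n)%R.
  by exists (fun n => b n - h n)%R.
have p0 n : (0 <= p n)%R by rewrite pE.
have pfin : sumZ p \is a fin_num.
  rewrite ge0_fin_numE ?sumZ_ge0//.
  apply: (@le_lt_trans _ _ (2%:E * sumZ b)); last by rewrite lte_mul_pinfty.
  apply: (le_trans _ (@sumZ_scale_le 2%R b _ b0)) => //; apply: le_sumZ => n.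
  by have := hb n; rewrite pE ler_norml => /andP[+ _]; lra.
have eb : sumZ (fun n => b (n - 1))%R = sumZ b := sumZ_shift b (-1).
have ep : sumZ (fun n => p (n - 1))%R = sumZ p := sumZ_shift p (-1).
(* Adding [p n + b (n - 1)] makes every summand nonnegative; after shifting, both sides carry the
   same finite total [sumZ p + sumZ b], which cancels. *)
have : sumZ (fun n => f n + (p n + b (n - 1)))%R <=
    sumZ (fun n => g n + (b n + p (n - 1)))%R.
  by apply: le_sumZ => n; have := fgh n; rewrite !pE; lra.
rewrite !sumZD// ?eb ?ep; do ?[by move=> n; rewrite addr_ge0].
by rewrite (addeC (sumZ b)) leeD2rE// fin_numD pfin bb.
Qed.

Lemma l2sq_ge0 u : 0 <= l2sq u.
Proof. by apply: sumZ_ge0 => n; exact: sqr_ge0. Qed.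

Lemma in_l2_fin u : in_l2 u -> exists c : R, l2sq u = c%:E.
Proof.
move=> uf; exists (fine (l2sq u)); rewrite fineK// ge0_fin_numE//.
exact: l2sq_ge0.
Qed.

Lemma sqr_le_l2sq u n : (u n ^+ 2)%:E <= l2sq u.
Proof.
have := @sum_le_sumZ (fun n => u n ^+ 2)%R [:: n] (fun n => sqr_ge0 (u n)) isT.
by rewrite big_seq1.
Qed.

Lemma l2sq_shift u k : l2sq (fun n => u (n + k)%R) = l2sq u.
Proof. exact: (@sumZ_shift (fun n => u n ^+ 2)%R k). Qed.

Lemma l2sqD_le u v : l2sq (fun n => u n + v n)%R <= 2%:E * (l2sq u + l2sq v).
Proof.
rewrite /l2sq -sumZD; [|by move=> n; exact: sqr_ge0..].
apply: le_trans (@sumZ_scale_le 2%R (fun n => u n ^+ 2 + v n ^+ 2)%R _ _) => //.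
  by apply: le_sumZ => n /=; have := sqr_ge0 (u n - v n)%R; nra.
by move=> n; rewrite addr_ge0 ?sqr_ge0.
Qed.

Lemma l2sq_mul_le u (a : int -> R) K : (forall n, `|a n| <= K)%R ->
  l2sq (fun n => a n * u n)%R <= (K ^+ 2)%:E * l2sq u.
Proof.
move=> aK.
apply: le_trans (@sumZ_scale_le (K ^+ 2)%R (fun n => u n ^+ 2)%R _ _).
- apply: le_sumZ => n; rewrite exprMn ler_wpM2r ?sqr_ge0//.
  by rewrite -real_normK ?num_real// lerXn2r ?nnegrE// (le_trans _ (aK n)).
- exact: sqr_ge0.
- by move=> n; exact: sqr_ge0.
Qed.

Lemma in_l2D u v : in_l2 u -> in_l2 v -> in_l2 (fun n => u n + v n)%R.
Proof.
move=> uf vf; apply: (le_lt_trans (l2sqD_le u v)).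
by rewrite lte_mul_pinfty// lte_add_pinfty.
Qed.

Lemma in_l2_mul u (a : int -> R) K : (forall n, `|a n| <= K)%R ->
  in_l2 u -> in_l2 (fun n => a n * u n)%R.
Proof.
move=> aK uf; apply: (le_lt_trans (l2sq_mul_le u aK)).
by rewrite lte_mul_pinfty ?lee_fin ?sqr_ge0.
Qed.

Lemma in_l2_shift u k : in_l2 u -> in_l2 (fun n => u (n + k)%R).
Proof. by rewrite /in_l2 l2sq_shift. Qed.

End SumZ.

(** * Coercivity and the resolvent *)

Section Coercive.
Context {R : realType}.
Variables (V : int -> R) (E delta K : R).
Let D n := V n - E.
Hypothesis delta_gt0 : 0 < delta.
Hypothesis D_ge : forall n, delta <= `|D n|.
Hypothesis K_ge1 : 1 <= K.
Hypothesis D_le : forall n, `|D n| <= K.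
Hypothesis D_edge : forall n, 0 < D n * D (n + 1) ->
  4 <= (`|D n| - delta) * (`|D (n + 1)| - delta).

(* The largest weights such that a site can pay for its two edges:
   [2 * weight n + delta <= `|D n|]. *)
Let weight n := (`|D n| - delta) / 2.

Definition signed_schr (u : int -> R) : int -> R :=
  fun n => Num.sg (D n) * schr_shift V E u n.

(* The flux through the edge [(n, n + 1)]. For [D] of equal signs it rebalances the
   AM-GM bound so that each endpoint is charged for its own square only; for opposite
   signs it makes the two hopping terms of the edge cancel. *)
Definition flux (u : int -> R) (n : int) : R :=
  if 0 < D n * D (n + 1) then (weight (n + 1) * u (n + 1) ^+ 2 - weight n * u n ^+ 2) / 2
  else - (Num.sg (D n) * u n * u (n + 1)).

Lemma D_neq0 n : D n != 0.
Proof. by rewrite -normr_gt0 (lt_le_trans delta_gt0). Qed.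

Lemma weight_ge0 n : 0 <= weight n.
Proof. by rewrite divr_ge0// subr_ge0. Qed.

Lemma sg_sqr n : Num.sg (D n) ^+ 2 = 1.
Proof. by rewrite sqr_sg D_neq0. Qed.

(** Since [p * q >= 1] forces [p > 0], one may multiply by [p] and complete the square in
    [p * x + s * y]. *)
Lemma weighted_amgm (p q x y s : R) : 0 <= p -> 0 <= q -> 1 <= p * q ->
  s ^+ 2 = 1 -> 0 <= s * x * y + (p * x ^+ 2 + q * y ^+ 2) / 2.
Proof.
move=> p0 q0 pq s1.
have p_gt0 : 0 < p.
  by rewrite lt_neqAle p0 andbT; apply/eqP => pE; move: pq; rewrite -pE mul0r ler10.
rewrite -(pmulr_rge0 _ p_gt0).
have -> : p * (s * x * y + (p * x ^+ 2 + q * y ^+ 2) / 2) =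
    ((p * x + s * y) ^+ 2 + (p * q - s ^+ 2) * y ^+ 2) / 2 by field.
by rewrite divr_ge0// addr_ge0 ?sqr_ge0// mulr_ge0 ?sqr_ge0// s1 subr_ge0.
Qed.

Lemma weight_edge n : 0 < D n * D (n + 1) -> 1 <= weight n * weight (n + 1).
Proof.
move=> /D_edge; rewrite /weight => H.
set A := _ - delta in H *; set B := _ - delta in H *; lra.
Qed.

(** For equal signs the flux symmetrizes the terms into the form of [weighted_amgm]; for opposite
    signs it removes the hopping term. *)
Lemma flux_right u n :
  0 <= Num.sg (D n) * u n * u (n + 1) + weight n * u n ^+ 2 + flux u n.
Proof.
rewrite /flux; case: ifPn => [/weight_edge an|_].
  have := weighted_amgm (u n) (u (n + 1)) (weight_ge0 n) (weight_ge0 (n + 1)) an (sg_sqr n).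
  lra.
have := mulr_ge0 (weight_ge0 n) (sqr_ge0 (u n)); lra.
Qed.

Lemma flux_left u n :
  0 <= Num.sg (D (n + 1)) * u (n + 1) * u n + weight (n + 1) * u (n + 1) ^+ 2 - flux u n.
Proof.
rewrite /flux; case: ifPn => [/weight_edge an|].
  have := weighted_amgm (u n) (u (n + 1)) (weight_ge0 n) (weight_ge0 (n + 1)) an (sg_sqr (n + 1)).
  lra.
rewrite -leNgt => DD.
(* The hopping term has opposite coefficients at the two ends of such an edge, so the same flux
   cancels it at both. *)
have -> : Num.sg (D n) = - Num.sg (D (n + 1)).
  move: DD (D_neq0 n) (D_neq0 (n + 1)).
  have [D1|D1|->] := ltgtP (D n) 0; have [D2|D2|->] := ltgtP (D (n + 1)) 0;
    rewrite ?eqxx// => DD _ _; rewrite ?(gtr0_sg D1) ?(ltr0_sg D1) ?(gtr0_sg D2) ?(ltr0_sg D2) ?opprK//; nra.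
have := mulr_ge0 (weight_ge0 (n + 1)) (sqr_ge0 (u (n + 1))); lra.
Qed.

(** Add [flux_right] at [n] and [flux_left] at [n - 1]: the two edges of the site use up
    [|D n| - delta] of the diagonal term [|D n|]. *)
Lemma coercive_pointwise u n :
  delta * u n ^+ 2 <= u n * signed_schr u n + (flux u n - flux u (n - 1)).
Proof.
have := flux_right u n; have := flux_left u (n - 1).
have aE : 2 * weight n = `|D n| - delta by rewrite /weight; field.
move: aE; rewrite subrK /signed_schr /schr_shift -/(D n) normrEsg.
set s := Num.sg _; set f := flux u n; set g := flux u (n - 1). nra.
Qed.

Lemma flux_le u n : `|flux u n| <= K * (u n ^+ 2 + u (n + 1) ^+ 2).
Proof.
have aK m : weight m <= K.
  by rewrite /weight; move: (D_le m) (D_ge m) delta_gt0; move: `|D m| => t; lra.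
have u0 m : 0 <= u m ^+ 2 by exact: sqr_ge0.
have b0 m : 0 <= weight m * u m ^+ 2 <= K * u m ^+ 2.
  by rewrite mulr_ge0 ?weight_ge0//= ler_wpM2r.
rewrite /flux; case: ifPn => _.
  by have := b0 n; have := b0 (n + 1); rewrite ler_norml; lra.
rewrite normrN !normrM normr_sg D_neq0 mul1r.
have := sqr_ge0 (`|u n| - `|u (n + 1)|); rewrite sqrrB !real_normK ?num_real//.
have s0 : 0 <= u n ^+ 2 + u (n + 1) ^+ 2 by rewrite addr_ge0 ?u0.
have := ler_peMl s0 K_ge1; move: (`|u n| * `|u (n + 1)|) (K * _) => p q; lra.
Qed.

Lemma in_l2_flux_bound (u : int -> R) c : 0 <= c -> in_l2 u ->
  (sumZ (fun n => c * (u n ^+ 2 + u (n + 1) ^+ 2)) < +oo)%E.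
Proof.
move=> c0 ul2.
apply: (@le_lt_trans _ _ (c%:E * (l2sq u + l2sq (fun n => u (n + 1)%R)))%E).
  rewrite /l2sq -sumZD; [|by move=> n; exact: sqr_ge0..].
  by apply: sumZ_scale_le => // n; rewrite addr_ge0 ?sqr_ge0.
by rewrite l2sq_shift lte_mul_pinfty ?lee_fin ?lte_add_pinfty.
Qed.

Lemma in_l2_schr u : in_l2 u -> in_l2 (schr_shift V E u).
Proof.
move=> ul2; apply: (in_l2D (u := fun n => u (n + 1) + u (n - 1))).
  exact: (in_l2D (in_l2_shift _ ul2) (in_l2_shift _ ul2)).
exact: (in_l2_mul D_le ul2).
Qed.

Lemma l2sq_signed_schr u : l2sq (signed_schr u) = l2sq (schr_shift V E u).
Proof. by apply: eq_esum => n _; rewrite /signed_schr exprMn sg_sqr mul1r. Qed.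

(** Coercivity bounds [delta * u n ^+ 2] by [u n * w] up to flux, with [w = signed_schr u n];
    expanding [(delta * u n - w) ^+ 2 >= 0] then absorbs half of the left side. *)
Lemma l2sq_le_schr u : in_l2 u ->
  (l2sq u <= (delta ^- 2)%:E * l2sq (schr_shift V E u))%E.
Proof.
move=> ul2; rewrite -l2sq_signed_schr.
apply: (@le_trans _ _ (sumZ (fun n => delta ^- 2 * signed_schr u n ^+ 2))); last first.
  by apply: sumZ_scale_le => [|n]; rewrite ?invr_ge0 sqr_ge0.
apply: (@le_sumZ_flux _ _ _ (fun n => 2 / delta * K * (u n ^+ 2 + u (n + 1) ^+ 2))
  (fun n => 2 / delta * flux u n)) => [n|n|n||n].
- exact: sqr_ge0.
- by rewrite mulr_ge0 ?invr_ge0 ?sqr_ge0.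
- by rewrite normrM gtr0_norm ?divr_gt0// -mulrA ler_wpM2l ?flux_le// ltW ?divr_gt0.
- by apply: in_l2_flux_bound => //; rewrite mulr_ge0 ?divr_ge0 ?(ltW delta_gt0)// (le_trans _ K_ge1).
- have := coercive_pointwise u n; set w := signed_schr u n; set h := _ - _ => H.
  rewrite -mulrBr -/h -(ler_pM2l (divr_gt0 delta_gt0 (ltr0Sn R 1))).
  have -> : delta / 2 * (delta ^- 2 * w ^+ 2 + 2 / delta * h) =
     w ^+ 2 / delta / 2 + h by field; rewrite gt_eqF.
  have : 0 <= (delta * u n - w) ^+ 2 / delta / 2.
    by rewrite !divr_ge0 ?sqr_ge0 ?(ltW delta_gt0).
  have -> : (delta * u n - w) ^+ 2 / delta / 2 =
     delta * u n ^+ 2 / 2 - u n * w + w ^+ 2 / delta / 2 by field; rewrite gt_eqF.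
  lra.
Qed.

(** * Inversion by a Neumann series *)

Let rho := delta / (9 * K ^+ 2).
Let r := 1 - rho * delta / 2.

Lemma K_gt0 : 0 < K. Proof. exact: lt_le_trans K_ge1. Qed.

Lemma rho_gt0 : 0 < rho.
Proof. by rewrite divr_gt0// mulr_gt0 ?exprn_gt0 ?K_gt0. Qed.

(** Cauchy-Schwarz for three terms; as [K >= 1], the factor [K ^+ 2] covers the hopping coefficients
    as well as [D n ^+ 2]. *)
Lemma signed_schr_sqr_le u n : signed_schr u n ^+ 2 <=
  3 * K ^+ 2 * (u n ^+ 2 + u (n + 1) ^+ 2 + u (n - 1) ^+ 2).
Proof.
rewrite /signed_schr exprMn sg_sqr mul1r /schr_shift -/(D n).
have H : D n ^+ 2 <= K ^+ 2.
  by rewrite -(real_normK (num_real (D n))) lerXn2r ?nnegrE// ltW ?K_gt0.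
have K1 : 1 <= K ^+ 2 by rewrite exprn_ege1.
have := ler_wpM2r (sqr_ge0 (u n)) H.
have := ler_wpM2r (sqr_ge0 (u (n + 1))) K1.
have := ler_wpM2r (sqr_ge0 (u (n - 1))) K1.
move: (u n) (u (n + 1)) (u (n - 1)) (D n) => x y z d.
have := sqr_ge0 (y - z); have := sqr_ge0 (y - d * x); have := sqr_ge0 (z - d * x).
nra.
Qed.

(* [rho] minimizes [1 - 2 rho delta + 9 rho^2 K^2], which bounds the contraction
   factor; the minimum [1 - rho delta] is at most [r ^ 2]. *)
Lemma contraction u : in_l2 u ->
  (l2sq (fun n => u n - rho * signed_schr u n)%R <= (r ^+ 2)%:E * l2sq u)%E.
Proof.
move=> ul2.
apply: (@le_trans _ _ (sumZ (fun n => r ^+ 2 * u n ^+ 2))); last first.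
  by apply: sumZ_scale_le => [|n]; rewrite sqr_ge0.
pose c := rho ^+ 2 * (3 * K ^+ 2).
have c0 : 0 <= c by rewrite mulr_ge0 ?sqr_ge0// mulr_ge0 ?sqr_ge0.
have rK : 0 <= 2 * rho * K.
  by have := mulr_ge0 (ltW rho_gt0) (ltW K_gt0); rewrite -mulrA; move: (rho * K) => t; lra.
(* The extra flux [c * (u (n + 1) ^+ 2 - u n ^+ 2)] trades the neighbouring squares of
   [signed_schr_sqr_le] for [2 * u n ^+ 2]; the error becomes [3 * c * u n ^+ 2] with
   [3 * c = rho * delta]. *)
apply: (@le_sumZ_flux _ _ _ (fun n => (2 * rho * K + c) * (u n ^+ 2 + u (n + 1) ^+ 2))
  (fun n => 2 * rho * flux u n + c * (u (n + 1) ^+ 2 - u n ^+ 2))) => [n|n|n||n].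
- exact: sqr_ge0.
- by rewrite mulr_ge0 ?sqr_ge0.
- have r2 : 0 <= 2 * rho by rewrite mulr_ge0 ?(ltW rho_gt0).
  rewrite [leRHS]mulrDl; apply: (le_trans (ler_normD _ _)); apply: lerD.
    by rewrite -[leRHS]mulrA normrM (ger0_norm r2) ler_wpM2l ?flux_le.
  rewrite normrM (ger0_norm c0) ler_wpM2l//.
  by have := sqr_ge0 (u n); have := sqr_ge0 (u (n + 1)); rewrite ler_norml; lra.
- by apply: in_l2_flux_bound; rewrite // addr_ge0.
- rewrite subrK.
  have := coercive_pointwise u n; have := signed_schr_sqr_le u n.
  move: (u n) (u (n + 1)) (u (n - 1)) (signed_schr u n) (flux u n)
    (flux u (n - 1)) => x y z w f g H1 H2.
  have {}H1 := ler_wpM2l (sqr_ge0 rho) H1.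
  have {}H2 := ler_wpM2l (ltW rho_gt0) H2.
  have rE : rho ^+ 2 * (3 * K ^+ 2) * 3 = rho * delta.
    by rewrite /rho; field; rewrite gt_eqF ?K_gt0.
  have r2 : (1 - rho * delta) * x ^+ 2 <= r ^+ 2 * x ^+ 2.
    by rewrite ler_wpM2r ?sqr_ge0// /r -subr_ge0; have := sqr_ge0 (rho * delta / 2); nra.
  have : (1 - rho * delta) * x ^+ 2 = x ^+ 2 - 2 * (rho * (delta * x ^+ 2)) + 3 * c * x ^+ 2.
    by rewrite -/c in rE; rewrite -(mulrC c) rE; ring.
  rewrite /c in r2 *; lra.
Qed.


Let step (u : int -> R) : int -> R := fun n => u n - rho * signed_schr u n.

Lemma signed_schrD u v n :
  signed_schr (fun m => u m + v m) n = signed_schr u n + signed_schr v n.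
Proof. by rewrite /signed_schr /schr_shift; ring. Qed.

Lemma r_ge0 : 0 <= r.
Proof.
have dK : delta <= K := le_trans (D_ge 0) (D_le 0).
have : rho * delta <= 2; last by rewrite /r; lra.
rewrite /rho mulrAC ler_pdivrMr ?mulr_gt0 ?exprn_gt0 ?K_gt0//.
have := ler_pM (ltW delta_gt0) (ltW delta_gt0) dK dK; rewrite -!expr2.
have := sqr_ge0 K; lra.
Qed.

Lemma r_lt1 : r < 1.
Proof. by have := mulr_gt0 rho_gt0 delta_gt0; rewrite /r; lra. Qed.

(* Neumann series for [u = rho J f + (1 - rho J (H - E)) u]. As [H] has finite range,
   pointwise convergence of the partial sums suffices to pass to the limit. *)
Lemma schr_surj f : in_l2 f -> exists2 u, in_l2 u & schr_shift V E u = f.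
Proof.
move=> fl2.
pose g n := rho * Num.sg (D n) * f n.
have gl2 : in_l2 g.
  apply: (in_l2_mul (K := rho)) fl2 => n.
  by rewrite normrM normr_sg D_neq0 mulr1 gtr0_norm ?rho_gt0.
have [c cE] := in_l2_fin gl2.
have c0 : 0 <= c by rewrite -lee_fin -cE l2sq_ge0.
pose v k := iter k step g.
have vl2 k : in_l2 (v k) /\ (l2sq (v k) <= (r ^+ k ^+ 2 * c)%:E)%E.
  elim: k => [|k [IHl2 IH]]; first by rewrite expr0 expr1n mul1r cE.
  have vk1 := contraction IHl2.
  have vk2 : (l2sq (v k.+1) <= (r ^+ k.+1 ^+ 2 * c)%:E)%E.
    apply: (le_trans vk1); rewrite (exprS r k) exprMn -mulrA [leRHS]EFinM.
    by rewrite lee_wpmul2l ?lee_fin ?sqr_ge0.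
  by split => //; apply: le_lt_trans vk2 _; rewrite ltry.
(* [c + 1] stands in for the square root of [c], since [c <= (c + 1) ^+ 2]. *)
have vle k n : `|v k n| <= r ^+ k * (c + 1).
  have := le_trans (sqr_le_l2sq (v k) n) (vl2 k).2.
  rewrite lee_fin -(real_normK (num_real _)) => H.
  rewrite -(@ler_pXn2r _ 2)// ?nnegrE ?mulr_ge0 ?exprn_ge0 ?r_ge0 ?addr_ge0//.
  apply: (le_trans H); rewrite exprMn ler_wpM2l ?sqr_ge0//.
  by rewrite sqrrD1; have := sqr_ge0 c; lra.
pose s k n : R := series (fun i => v i n) k.
have s_cvg n : cvgn (s ^~ n).
  apply: normed_cvg.
  apply: (@series_le_cvg _ _ (geometric (c + 1) r)) => [i|i|i|] //=.
  - by rewrite mulr_ge0 ?exprn_ge0 ?r_ge0 ?addr_ge0.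
  - by rewrite mulrC vle.
  - by apply: is_cvg_geometric_series; rewrite ger0_norm ?r_ge0 ?r_lt1.
have sS k n : s k.+1 n = s k n + v k n by rewrite /s /series /= big_nat_recr.
have s_rec k n : s k.+1 n = g n + step (s k) n.
  elim: k => [|k IH] in n *.
    rewrite sS /step /signed_schr /schr_shift /s /series /= !big_geq//.
    rewrite /v /=; ring.
  rewrite sS IH (_ : s k.+1 = fun m => s k m + v k m); last by apply/funext => m; rewrite sS.
  by rewrite /step signed_schrD /v /= /step; ring.
have sl2 k : in_l2 (s k).
  elim: k => [|k IH].
    rewrite /in_l2 /l2sq esum1 ?ltry// => n _.
    by rewrite /s /series /= big_geq// expr0n.
  rewrite (_ : s k.+1 = fun m => s k m + v k m); last by apply/funext => m; rewrite sS.
  exact: in_l2D IH (vl2 k).1.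
(* Comparing [sS] with [s_rec] identifies the residual of the partial sum [s k] as [v k]. *)
have signed_s k n : signed_schr (s k) n = rho^-1 * (g n + -1 * v k n).
  have := sS k n; rewrite s_rec /step => H.
  have -> : g n + -1 * v k n = rho * signed_schr (s k) n by lra.
  by rewrite mulKf// gt_eqF ?rho_gt0.
(* Through [l2sq_le_schr], the bound [c] on [l2sq g] and [l2sq (v k)] bounds [s k] uniformly in
   [k]. *)
pose b := delta ^- 2 * (rho^-1 ^+ 2 * (2 * (c + c))).
have s_le k : (l2sq (s k) <= b%:E)%E.
  apply: (le_trans (l2sq_le_schr (sl2 k))); rewrite /b EFinM.
  apply: lee_wpmul2l; first by rewrite lee_fin invr_ge0 sqr_ge0.
  rewrite -l2sq_signed_schr (_ : signed_schr (s k) = fun n => rho^-1 * (g n + -1 * v k n));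
    last by apply/funext => n; rewrite signed_s.
  apply: (le_trans (l2sq_mul_le (K := rho^-1) _ _)) => [n|].
    by rewrite gtr0_norm ?invr_gt0 ?rho_gt0.
  rewrite [leRHS]EFinM; apply: lee_wpmul2l; first by rewrite lee_fin sqr_ge0.
  apply: (le_trans (l2sqD_le _ _)); rewrite [leRHS]EFinM.
  apply: lee_wpmul2l; first by rewrite lee_fin.
  rewrite cE EFinD leeD2l//.
  apply: (le_trans (l2sq_mul_le (K := 1) _ _)) => [n|]; first by rewrite normrN1.
  rewrite expr1n mul1e; apply: (le_trans (vl2 k).2); rewrite lee_fin ler_piMl//.
  by rewrite exprn_ile1 ?exprn_ge0 ?exprn_ile1 ?r_ge0 ?(ltW r_lt1).
pose u n : R := limn (s ^~ n).
(* As in Fatou's lemma, finite sums of squares pass to the limit under the uniform bound [b]. *)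
have ul2 : in_l2 u.
  apply: (@le_lt_trans _ _ b%:E); rewrite ?ltry//.
  apply: sumZ_lub => t ut.
  apply: (@cvgr_to_le nat \oo _ R (fun k => \sum_(n <- t) s k n ^+ 2)).
    apply: cvg_big => [|n _]; first exact: add_continuous.
    exact: cvgM (s_cvg n) (s_cvg n).
  apply: nearW => k; rewrite -lee_fin; apply: le_trans (s_le k).
  by apply: sum_le_sumZ => // n; rewrite sqr_ge0.
exists u => //; apply/funext => n.
(* The limit satisfies the fixed-point equation [u n = g n + step u n], which rearranges to this
   identity. *)
have ss : rho * Num.sg (D n) * schr_shift V E u n = rho * Num.sg (D n) * f n.
  have H1 : (fun k => g n + step (s k) n) @ \oo --> g n + step u n.
    rewrite /step /signed_schr /schr_shift.
    apply: cvgD; first exact: cvg_cst.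
    apply: cvgB; first exact: s_cvg.
    apply: cvgM; first exact: cvg_cst.
    apply: cvgM; first exact: cvg_cst.
    apply: cvgD; first by apply: cvgD; exact: s_cvg.
    by apply: cvgM; [exact: cvg_cst|exact: s_cvg].
  have H2 : (fun k => g n + step (s k) n) @ \oo --> u n.
    rewrite (_ : (fun k => _) = (fun k => s k.+1 n)); last by apply/funext => k; rewrite s_rec.
    by rewrite (cvg_shiftS (s ^~ n)); exact: s_cvg.
  have : g n + step u n = u n := cvg_unique (@norm_hausdorff _ _) H1 H2.
  rewrite /g /step /signed_schr; move: (schr_shift V E u n) (Num.sg (D n)) => x y H.
  have -> : rho * y * x = rho * y * f n +
      (u n - (rho * y * f n + (u n - rho * (y * x)))) by ring.
  by rewrite H subrr addr0.
by apply: mulfI ss; rewrite mulf_neq0 ?sgr_eq0 ?D_neq0// gt_eqF ?rho_gt0.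
Qed.

Lemma coercive_bounded_inverse : has_bounded_inverse V E.
Proof.
have /choice[G GE] : forall f, exists u, in_l2 f -> in_l2 u /\ schr_shift V E u = f.
  move=> f.
  have [/schr_surj[u]|nf] := pselect (in_l2 f); first by exists u.
  by exists f.
exists G; split => [f /GE[]//||f /GE[]//|u ul2].
  exists (delta ^- 2) => f /GE[Gl2 {2}<-]; exact: l2sq_le_schr.
(* Left inverse: the difference of [G (schr_shift V E u)] and [u] is annihilated by the operator,
   hence zero by [l2sq_le_schr]. *)
have [Gl2 LG] := GE _ (in_l2_schr ul2).
have wl2 : in_l2 (fun n => G (schr_shift V E u) n + -1 * u n).
  by apply: in_l2D Gl2 (in_l2_mul (K := 1) _ ul2) => n; rewrite normrN1.
have := l2sq_le_schr wl2.
rewrite [X in (_ * X)%E](_ : _ = 0%E) ?mule0 => [w0|].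
  apply/funext => n; have := le_trans (sqr_le_l2sq _ n) w0.
  by rewrite lee_fin real_exprn_even_le0//= mulN1r subr_eq0 => /eqP.
apply: esum1 => n _; have := congr1 (@^~ n) LG.
rewrite /schr_shift => H; congr _%:E; apply/eqP; rewrite sqrf_eq0; apply/eqP; lra.
Qed.

End Coercive.

(** * Truncated Bloch waves *)

Section Weyl.
Context {R : realType}.
Implicit Types (V u : int -> R) (E C : R).

Lemma sumZ_supp (f : int -> R) (s : seq int) : (forall n, 0 <= f n) -> uniq s ->
  (forall n, n \notin s -> f n = 0) -> sumZ f = (\sum_(n <- s) f n)%:E.
Proof.
move=> f0 us fs; rewrite (esumID [set` s]); last by move=> n _; rewrite lee_fin.
rewrite [X in (_ + X)%E]esum1 ?adde0; last first.
  by move=> n [_ /negP ns]; rewrite fs.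
rewrite setTI esum_fset; [|exact: finite_seq|by move=> n _; rewrite lee_fin].
by rewrite -fsbig_seq//= sumEFin.
Qed.

Lemma sumZ_delta (k : int) : sumZ (fun n => (n == k)%:R : R) = 1%E.
Proof.
rewrite (@sumZ_supp _ [:: k])//; first by rewrite big_seq1 eqxx.
by move=> n; rewrite inE => /negbTE ->.
Qed.

(** A homogeneous 2x2 system of determinant zero. With [x = E - a] and [y = E - b], its solution
    gives the amplitudes of a Bloch wave at even and odd sites. The generic solution degenerates at
    [x = 0]. *)
Lemma bloch_eigenvector (x y : R) : 0 <= x * y ->
  exists p q, [/\ 0 < p ^+ 2 + q ^+ 2, q * Num.sqrt (x * y) = x * p
    & p * Num.sqrt (x * y) = y * q].
Proof.
move=> xy; have [->|x0] := eqVneq x 0.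
  by exists 1, 0; rewrite !mul0r sqrtr0 !mulr0 expr1n expr0n addr0 ltr01.
exists (Num.sqrt (x * y)), x; split.
- by rewrite ltr_wpDl ?sqr_ge0// exprn_even_gt0.
- by [].
- by rewrite -expr2 sqr_sqrtr// mulrC.
Qed.

Section stretch.
Variables (V : int -> R) (E a b p q c : R) (m : int) (L : nat) (psi : int -> R).
Hypothesis V_per : forall n : int, m <= n < m + L%:Z ->
  V n = if (2 %| n)%Z then a else b.
Hypothesis pq : q * c = (E - a) * p.
Hypothesis qp : p * c = (E - b) * q.
Hypothesis psi_rec : forall n, psi (n + 1) + psi (n - 1) = c * psi n.
Hypothesis psi_le1 : forall n, psi n ^+ 2 <= 1.

Let w (n : int) := if (2 %| n)%Z then p else q.
Let phi n := w n * psi n.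
Let chi (n : int) : R := (m <= n < m + L%:Z)%R%:R.
Let B := p ^+ 2 + q ^+ 2.

Definition truncation n := chi n * phi n.

(** [phi] solves the eigenvalue equation inside the stretch, so only the commutator with the cutoff
    [chi] survives. *)
Lemma schr_truncation n : schr_shift V E truncation n =
  (chi (n + 1) - chi n) * phi (n + 1) + (chi (n - 1) - chi n) * phi (n - 1).
Proof.
suff : chi n * (phi (n + 1) + phi (n - 1) + (V n - E) * phi n) = 0.
  by move=> H; apply/eqP; rewrite -subr_eq0 -H /schr_shift /truncation; apply/eqP; ring.
rewrite /chi; case: (boolP (_ <= n < _)) => [nm|_]; last by rewrite mul0r.
rewrite mul1r V_per// /phi /w.
have -> : (2 %| n - 1)%Z = ~~ (2 %| n)%Z by lia.
have -> : (2 %| n + 1)%Z = ~~ (2 %| n)%Z by lia.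
by case: (2 %| n)%Z; rewrite /= -mulrDr psi_rec mulrA ?pq ?qp; ring.
Qed.

Lemma phi_sqr_le n : phi n ^+ 2 <= B.
Proof.
rewrite /phi exprMn.
have -> : B = B * 1 by rewrite mulr1.
apply: ler_pM; rewrite ?sqr_ge0// /w /B.
by case: ifP => _; rewrite ?lerDl ?lerDr sqr_ge0.
Qed.

Lemma jump_sqr_le n :
  (chi (n + 1) - chi n) ^+ 2 <= (n == m - 1)%R%:R + (n == m + L%:Z - 1)%R%:R.
Proof.
rewrite /chi.
have [h1|h1] := boolP (m <= n + 1 < m + L%:Z); have [h2|h2] := boolP (m <= n < m + L%:Z);
  rewrite /= ?subrr ?subr0 ?sub0r ?sqrrN ?expr1n ?expr0n ?addr_ge0//.
- rewrite (_ : n == m - 1); [by rewrite lerDl ler0n|lia].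
- rewrite (_ : n == m + L%:Z - 1); [by rewrite lerDr ler0n|lia].
Qed.

(* [schr_shift V E truncation] lives on the edges where [chi] jumps. *)
Lemma l2sq_schr_truncation : (l2sq (schr_shift V E truncation) <= (8 * B)%:E)%E.
Proof.
have B0 : 0 <= B by rewrite addr_ge0 ?sqr_ge0.
pose d (k n : int) : R := (n == k)%:R.
pose k1 : int := m - 1; pose k2 : int := m + L%:Z - 1.
(* Point masses at the sites adjacent to the two jumps, of total mass 4. Bounding the square of a
   sum of two terms by twice the sum of squares yields [8 * B]. *)
pose g (n : int) := (d k1 n + d k2 n) + (d k1 (n - 1) + d k2 (n - 1)).
have d0 k n : 0 <= d k n by [].
have g0 n : 0 <= g n by rewrite !addr_ge0.
have gE : sumZ g = 4%:E.
  rewrite /g (@sumZD _ (fun n => d k1 n + d k2 n) (fun n => d k1 (n - 1) + d k2 (n - 1)));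
    [|by move=> n; rewrite addr_ge0..].
  rewrite (@sumZ_shift _ (fun n => d k1 n + d k2 n) (-1)) (@sumZD _ (d k1) (d k2))//.
  by rewrite !sumZ_delta -!EFinD; congr _%:E; ring.
apply: (@le_trans _ _ (sumZ (fun n => (2 * B) * g n))).
  apply: le_sumZ => n; rewrite schr_truncation.
  have j1 := jump_sqr_le n; have := jump_sqr_le (n - 1); rewrite subrK => j2.
  have {}j1 := ler_pM (sqr_ge0 _) (sqr_ge0 _) j1 (phi_sqr_le (n + 1)).
  have {}j2 := ler_pM (sqr_ge0 _) (sqr_ge0 _) j2 (phi_sqr_le (n - 1)).
  rewrite /g /d /k1 /k2.
  move: j1 j2; rewrite -!exprMn -(sqrrN ((_ - _) * phi (n - 1))) -mulNr opprB.
  set X := (chi (n + 1) - _) * _; set Y := (chi (n - 1) - _) * _ => j1 j2.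
  have := sqr_ge0 (X - Y); nra.
apply: (le_trans (sumZ_scale_le _ _)) => //; first by rewrite mulr_ge0.
by rewrite gE -EFinM lee_fin; lra.
Qed.

Let s := [seq m + i%:Z | i <- iota 0 L].

Lemma l2sq_truncation :
  l2sq truncation = (\sum_(0 <= i < L) (w (m + i%:Z) * psi (m + i%:Z)) ^+ 2)%:E.
Proof.
have us : uniq s by rewrite map_inj_uniq ?iota_uniq// => i j /addrI[].
have chiE n : chi n = (n \in s)%:R.
  rewrite /chi; congr (nat_of_bool _)%:R; apply/idP/mapP => [nm|[i]].
    by exists `|n - m|%N; rewrite ?mem_iota; lia.
  by rewrite mem_iota => iL ->; lia.
rewrite /l2sq (@sumZ_supp _ s)//; first last.
- by move=> n ns; rewrite /truncation chiE (negbTE ns) mul0r expr0n.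
- by move=> n; rewrite sqr_ge0.
rewrite big_map /index_iota subn0; congr _%:E.
apply: eq_big_seq => i iL; rewrite /truncation chiE (_ : _ \in s) ?mul1r//.
exact: map_f.
Qed.

End stretch.

Lemma cos_sin_recurrence (t : R) (n : int) :
  cos ((n + 1)%:~R * t) + cos ((n - 1)%:~R * t) = 2 * cos t * cos (n%:~R * t) /\
  sin ((n + 1)%:~R * t) + sin ((n - 1)%:~R * t) = 2 * cos t * sin (n%:~R * t).
Proof.
by rewrite intrD intrB mulrDl mulrBl mul1r cosD cosB sinD sinB; split; ring.
Qed.

(* Cosine and sine waves are used together so that the squares add up to the
   constant 1 and no lower bound on a single wave is needed. *)
Lemma long_stretch_bound V E a b C (m : int) (N : nat) : 0 <= C ->
  0 <= (E - a) * (E - b) <= 4 ->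
  (forall n : int, m <= n < m + N.*2%:Z -> V n = if (2 %| n)%Z then a else b) ->
  (forall u, in_l2 u -> in_l2 (schr_shift V E u) ->
     (l2sq u <= C%:E * l2sq (schr_shift V E u))%E) ->
  N%:R <= 16 * C.
Proof.
move=> C0 /andP[xy0 xy4] Vper HC.
have [p [q [B0 pq qp]]] := bloch_eigenvector xy0.
set c := Num.sqrt _ in pq qp.
have c02 : 0 <= c <= 2.
  rewrite sqrtr_ge0 -(@ler_pXn2r _ 2) ?nnegrE ?sqrtr_ge0// sqr_sqrtr//.
  by apply: (le_trans xy4); rewrite expr2; lra.
(* [(E - a) * (E - b) <= 4] gives [c <= 2], so cosine and sine of [n * t] are bounded solutions of
   the recurrence with coefficient [c]. *)
pose t := acos (c / 2).
have ct : 2 * cos t = c.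
  by rewrite acosK ?in_itv/=; [field|lra].
pose w (n : int) := if (2 %| n)%Z then p else q.
have bound psi : (forall n, psi (n + 1) + psi (n - 1) = c * psi n) ->
    (forall n, psi n ^+ 2 <= 1) ->
    \sum_(0 <= i < N.*2) (w (m + i%:Z) * psi (m + i%:Z)) ^+ 2 <=
      C * (8 * (p ^+ 2 + q ^+ 2)).
  move=> psi_rec psi1.
  pose u := truncation p q m N.*2 psi.
  have uE : l2sq u = _ := l2sq_truncation p q m N.*2 psi.
  have Lu : (l2sq (schr_shift V E u) <= _)%E :=
    l2sq_schr_truncation Vper pq qp psi_rec psi1.
  rewrite -lee_fin -uE EFinM; apply: (le_trans (HC u _ _)).
  - by rewrite /in_l2 uE ltry.
  - by apply: le_lt_trans Lu _; rewrite ltry.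
  - by apply: lee_wpmul2l; rewrite ?lee_fin.
have Hc := bound (fun n => cos (n%:~R * t)).
have {}Hc := Hc (fun n => ltac:(by have [-> _] := cos_sin_recurrence t n; rewrite ct))
  (fun n => ltac:(have := cos2Dsin2 (n%:~R * t); have := sqr_ge0 (sin (n%:~R * t)); lra)).
have Hs := bound (fun n => sin (n%:~R * t)).
have {}Hs := Hs (fun n => ltac:(by have [_ ->] := cos_sin_recurrence t n; rewrite ct))
  (fun n => ltac:(have := cos2Dsin2 (n%:~R * t); have := sqr_ge0 (cos (n%:~R * t)); lra)).
have := lerD Hc Hs; rewrite -big_split /=.
rewrite (eq_bigr (fun i : nat => w (m + i%:Z) ^+ 2)); last first.
  by move=> i _; rewrite !exprMn -mulrDr cos2Dsin2 mulr1.
(* The even length pairs even with odd sites, each pair contributing [p ^+ 2 + q ^+ 2]. *)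
have -> : \sum_(0 <= i < N.*2) w (m + i%:Z) ^+ 2 = N%:R * (p ^+ 2 + q ^+ 2).
  elim: N {HC bound Vper Hc Hs} => [|k IH]; first by rewrite big_geq// mul0r.
  rewrite doubleS !big_nat_recr//= IH -natr1 mulrDl mul1r -addrA; congr (_ + _).
  rewrite /w (_ : (2 %| m + k.*2.+1%:Z)%Z = ~~ (2 %| m + k.*2%:Z)%Z); last by lia.
  by case: ifP => _ //=; rewrite addrC.
move=> H; rewrite -(ler_pM2r B0); move: H; set z := p ^+ 2 + q ^+ 2; lra.
Qed.

Lemma long_stretches_spectrum V E a b :
  0 <= (E - a) * (E - b) <= 4 ->
  (forall N : nat, exists m : int, forall n : int, m <= n < m + N.*2%:Z ->
     V n = if (2 %| n)%Z then a else b) ->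
  spectrum V E.
Proof.
move=> Eab Vst [G [Gl2 [C GC] LG GL]].
pose C' := Num.max 0 C.
have C'0 : 0 <= C' by rewrite le_max lexx.
(* More than [16 * C'] pairs of sites contradict [long_stretch_bound]. *)
have [m Vm] := Vst (Num.truncn (16 * C')).+1.
have := long_stretch_bound C'0 Eab Vm.
have H u : in_l2 u -> in_l2 (schr_shift V E u) ->
    (l2sq u <= C'%:E * l2sq (schr_shift V E u))%E.
  move=> ul2 Lul2; rewrite -{1}(GL _ ul2); apply: (le_trans (GC _ Lul2)).
  by rewrite lee_wpmul2r ?l2sq_ge0// lee_fin le_max lexx orbT.
move=> /(_ H); apply/negP; rewrite -ltNge.
by rewrite truncnS_gt.
Qed.

End Weyl.

(** * Patterns occurring almost surely *)

Section Prob.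
Context {R : realType} {d : measure_display} {T : measurableType d}.
Variables (P : probability T R) (V : int -> T -> R) (pat : int -> R) (pi0 : R).
Hypothesis V_meas : forall n, measurable_fun [set: T] (V n).
Hypothesis V_indep : independent_rvs P V.
Hypothesis pi0_gt0 : 0 < pi0.
Hypothesis pat_ge : forall n, (pi0%:E <= P (V n @^-1` [set pat n]))%E.

Definition cylinder (s : seq int) : set T :=
  \big[setI/setT]_(j <- s) (V j @^-1` [set pat j]).

Lemma cylinderP s w : cylinder s w <-> forall j, j \in s -> V j w = pat j.
Proof.
rewrite /cylinder; elim: s => [|j s IH]; first by rewrite big_nil.
rewrite big_cons; split => [[jw /IH sw] i|H].
  by rewrite inE => /predU1P[->//|/sw].
by split; [apply: H; rewrite mem_head|apply/IH => i si; apply: H; rewrite inE si orbT].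
Qed.

Lemma measurable_cylinder s : measurable (cylinder s).
Proof.
apply: bigsetI_measurable => j _.
by rewrite -[X in measurable X]setTI; apply: V_meas.
Qed.

Lemma prob_cylinder s : uniq s ->
  P (cylinder s) = (\prod_(j <- s) P (V j @^-1` [set pat j]))%E.
Proof. by move=> us; apply: V_indep. Qed.

Lemma prob_cylinder_ge s : uniq s -> ((pi0 ^+ size s)%:E <= P (cylinder s))%E.
Proof.
move=> us; rewrite prob_cylinder//; elim: s {us} => [|j s IH].
  by rewrite big_nil.
rewrite big_cons exprS EFinM; apply: lee_pmul => //.
  by rewrite lee_fin ltW.
by rewrite lee_fin exprn_ge0// ltW.
Qed.

Variable L : nat.

(** Consecutive windows of length [L], disjoint for distinct [k], so that independence applies to
    their cylinders. *)
Definition block (k : nat) : seq int := [seq (L * k + i)%N%:Z | i <- iota 0 L].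

Lemma uniq_block k : uniq (block k).
Proof. by rewrite map_inj_uniq ?iota_uniq// => i j [] /addnI. Qed.

Lemma mem_block k (n : int) : n \in block k ->
  (L * k)%N%:Z <= n < (L * k.+1)%N%:Z.
Proof. by move=> /mapP[i]; rewrite mem_iota => /andP[_ iL] ->; rewrite mulnS; lia. Qed.

Definition no_block (K : nat) : set T :=
  \big[setI/setT]_(0 <= k < K) ~` cylinder (block k).

Lemma measurable_no_block K : measurable (no_block K).
Proof.
by apply: bigsetI_measurable => k _; apply: measurableC; exact: measurable_cylinder.
Qed.

(* The extra cylinder [s] makes the induction on [K] go through using independence
   for cylinders only. *)
Lemma prob_cylinder_no_block K s : uniq s ->
  (forall k j, (k < K)%N -> j \in block k -> j \notin s) ->
  P (cylinder s `&` no_block K) =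
  (P (cylinder s) * \prod_(0 <= k < K) (1 - P (cylinder (block k))))%E.
Proof.
elim: K s => [|K IH] s us disj; first by rewrite /no_block !big_geq// setIT mule1.
have usb : uniq (s ++ block K).
  rewrite cat_uniq us uniq_block andbT /=; apply/hasPn => j.
  exact: disj.
have E1 : cylinder (s ++ block K) = cylinder s `&` cylinder (block K).
  by rewrite /cylinder big_cat.
have PE : P (cylinder (s ++ block K)) = (P (cylinder s) * P (cylinder (block K)))%E.
  by rewrite !prob_cylinder ?uniq_block// big_cat.
have IHs := IH s us (fun k j kK => disj k j (ltnW kK)).
have db k j : (k < K)%N -> j \in block k -> j \notin s ++ block K.
  move=> kK jk; rewrite mem_cat negb_or (disj k j (ltnW kK) jk)/=.
  apply/negP => /mem_block; move: jk => /mem_block; nia.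
have IHb := IH _ usb db.
(* The event is a difference: what is removed, a match on block [K], is again a cylinder intersected
   with [no_block K], so the induction hypothesis gives both probabilities. *)
rewrite [X in P X](_ : _ =
    (cylinder s `&` no_block K) `\` (cylinder (s ++ block K) `&` no_block K)).
  rewrite measureD.
  - rewrite [X in (_ - P X)%E](_ : _ = cylinder (s ++ block K) `&` no_block K); last first.
      by apply/setIidr; rewrite E1; apply: setSI; exact: subIsetl.
    transitivity (P (cylinder s `&` no_block K) - P (cylinder (s ++ block K) `&` no_block K))%E => //.
    rewrite IHs IHb PE big_nat_recr//=.
    have yfin : (\prod_(0 <= k < K) (1 - P (cylinder (block k))))%E \is a fin_num.
      apply: prode_fin_num => k _; rewrite fin_numB fin_num_measure//.
      exact: measurable_cylinder.
    have fin t : P (cylinder t) \is a fin_num.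
      by rewrite fin_num_measure//; exact: measurable_cylinder.
    move: yfin (fin s) (fin (block K)).
    move: (P (cylinder s)) (P (cylinder (block K))) (\prod_(_ <= k < K) _)%E.
    by move=> [x| |] [z| |] [y| |] //= _ _ _; congr _%:E; rewrite /=; ring.
  - by apply: measurableI; [exact: measurable_cylinder|exact: measurable_no_block].
  - by apply: measurableI; [exact: measurable_cylinder|exact: measurable_no_block].
  - by rewrite (le_lt_trans (probability_le1 _ _)) ?ltry//;
      apply: measurableI; [exact: measurable_cylinder|exact: measurable_no_block].
rewrite E1 /no_block big_nat_recr//= -/(no_block K).
apply/seteqP; split => w /=; [move=> [sw [nw bw]]; split => //; tauto|tauto].
Qed.

Lemma prob_no_block K : (P (no_block K) <= ((1 - pi0 ^+ L) ^+ K)%:E)%E.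
Proof.
have := @prob_cylinder_no_block K [::] isT (fun k j _ _ => isT).
have -> : cylinder [::] = setT by rewrite /cylinder big_nil.
rewrite setTI probability_setT mul1e => ->.
have rho0 : 0 <= 1 - pi0 ^+ L.
  have := le_trans (prob_cylinder_ge (uniq_block 0))
    (probability_le1 P (measurable_cylinder (block 0))).
  by rewrite size_map size_iota lee_fin subr_ge0.
have p1 k : (0 <= 1 - P (cylinder (block k)))%E.
  by rewrite sube_ge0 ?orbT//; exact: (probability_le1 P (measurable_cylinder (block k))).
elim: K => [|K IH]; first by rewrite big_geq.
rewrite big_nat_recr//= exprSr EFinM; apply: lee_pmul => //.
- by apply: prode_ge0 => k _; exact: p1.
- rewrite EFinB leeB//.
  by have := prob_cylinder_ge (uniq_block K); rewrite size_map size_iota.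
Qed.

(** The exceptional event lies in every [no_block K], whose probability decays geometrically in
    [K]. *)
Lemma ae_some_block : {ae P, forall w, exists k, cylinder (block k) w}.
Proof.
have mA : measurable (\bigcap_k (~` cylinder (block k))).
  by apply: bigcap_measurable => // k _; apply: measurableC; exact: measurable_cylinder.
exists (\bigcap_k (~` cylinder (block k))); split => //.
- apply/eqP; rewrite eq_le measure_ge0 andbT.
  have le K : (P (\bigcap_k (~` cylinder (block k))) <= ((1 - pi0 ^+ L) ^+ K)%:E)%E.
    apply: le_trans (prob_no_block K).
    apply: le_measure; [exact: mem_set|exact: mem_set (measurable_no_block K)|].
    move=> w Aw; rewrite /no_block; elim: K => [|K IH]; first by rewrite big_geq.
    by rewrite big_nat_recr//=; split => //; exact: Aw.
  have Pfin : P (\bigcap_k (~` cylinder (block k))) \is a fin_num by rewrite fin_num_measure.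
  rewrite -(fineK Pfin) lee_fin.
  have q0 : 0 <= 1 - pi0 ^+ L.
    by have := le_trans (measure_ge0 _ _) (prob_no_block 1); rewrite lee_fin expr1.
  apply: (@cvgr_to_ge nat \oo _ R (fun K => (1 - pi0 ^+ L) ^+ K)).
    by apply: cvg_expr; rewrite ger0_norm// ltrBlDr ltrDl exprn_gt0.
  by apply: nearW => K; rewrite -lee_fin fineK.
- by move=> w /= /forallNP nw k _; exact: nw.
Qed.

End Prob.

(** * Bands of the 2-periodic operators *)

Section Bands.
Context {R : realType}.
Implicit Types (a b v E x y : R).

(* The part of the spectrum of the 2-periodic operator that is adjacent to [a]. *)
Definition near_band (a b E : R) : Prop :=
  0 <= (E - a) * (E - b) <= 4 /\ `|E - a| <= `|E - b|.

Lemma near_band_itv_lt a b : a < b ->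
  exists2 lo, lo <= a & forall E, near_band a b E <-> lo <= E <= a.
Proof.
(* [t] is the nonnegative root of [t * (t + r) = 4], so [(E - a) * (E - b)] reaches 4 at
   [E = a - t]. *)
move=> ab; pose r := b - a; pose t := Num.sqrt ((r / 2) ^+ 2 + 4) - r / 2.
have r0 : 0 < r by rewrite subr_gt0.
have s0 : 0 <= (r / 2) ^+ 2 + 4 by rewrite addr_ge0 ?sqr_ge0.
have t0 : 0 <= t.
  rewrite subr_ge0 -[leLHS]ger0_norm; last by rewrite divr_ge0 ?ltW.
  by rewrite -sqrtr_sqr ler_wsqrtr// lerDl.
have tr : t * (t + r) = 4.
  have -> : t * (t + r) = Num.sqrt ((r / 2) ^+ 2 + 4) ^+ 2 - (r / 2) ^+ 2 by rewrite /t; field.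
  by rewrite sqr_sqrtr//; ring.
clearbody t.
exists (a - t) => [|E]; first by rewrite lerBlDr lerDl.
rewrite /near_band; have bE : b = a + r by rewrite /r; ring.
rewrite bE; clearbody r; split => [[/andP[h0 h4] hn]|/andP[h1 h2]].
  have Ea : E <= a.
    rewrite leNgt; apply/negP => aE.
    have Eb : 0 <= E - (a + r) by rewrite -(pmulr_rge0 _ (_ : 0 < E - a))// subr_gt0.
    by move: hn; rewrite !ger0_norm//; lra.
  by rewrite Ea andbT; nra.
split; first by apply/andP; split; nra.
by rewrite !ler0_norm; lra.
Qed.

Lemma near_bandN a b E : near_band (- a) (- b) (- E) <-> near_band a b E.
Proof.
rewrite /near_band (_ : - E - - a = - (E - a)); last by ring.
by rewrite (_ : - E - - b = - (E - b)) ?mulrNN ?normrN//; ring.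
Qed.

Lemma near_band_itv a b :
  exists lo hi, lo <= a <= hi /\ forall E, near_band a b E <-> lo <= E <= hi.
Proof.
have [/near_band_itv_lt[lo loa H]|ba|<-] := ltgtP a b.
- by exists lo, a; rewrite loa lexx.
- have /near_band_itv_lt[lo loa H] : - a < - b by rewrite ltrN2.
  exists a, (- lo); rewrite lexx lerNr; split => // E.
  by rewrite -near_bandN H lerNr lerN2 andbC.
- exists (a - 2), (a + 2); split; first by lra.
  move=> E; rewrite /near_band lexx -expr2 sqr_ge0 /=; split => [[h _]|h].
    by apply/andP; split; nra.
  by split => //; nra.
Qed.

(** Both intervals contain [v], so their union is their convex hull. *)
Lemma near_band_itv2 v x y : exists lo hi,
  forall E, near_band v x E \/ near_band v y E <-> lo <= E <= hi.
Proof.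
have [l1 [h1 [vx H1]]] := near_band_itv v x.
have [l2 [h2 [vy H2]]] := near_band_itv v y.
exists (Num.min l1 l2), (Num.max h1 h2) => E; rewrite H1 H2.
move/andP: vx => [? ?]; move/andP: vy => [? ?].
rewrite ge_min le_max; split => [[/andP[-> ->]|/andP[-> ->]]|]; rewrite ?orbT//.
case: (leP E v) => Ev.
  by move=> /andP[/orP[->|->] _]; [left|right]; apply: le_trans Ev _.
by move=> /andP[_ /orP[->|->]]; [left|right]; rewrite andbT; apply: le_trans (ltW Ev).
Qed.

Definition bands (av bv : bool -> R) : set R :=
  [set E | exists i j, 0 <= (E - av i) * (E - bv j) <= 4].

(** An energy in the band of [av i] and [bv j] is assigned to the closer of the two values; each of
    the four values thus collects two near bands, merged by [near_band_itv2]. *)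
Lemma bands_four_itv (av bv : bool -> R) :
  exists a b : 'I_4 -> R, bands av bv = \bigcup_(i in [set: 'I_4]) `[a i, b i]%classic.
Proof.
have H v (f : bool -> R) := near_band_itv2 v (f false) (f true).
have [l0 [h0 H0]] := H (av false) bv; have [l1 [h1 H1]] := H (av true) bv.
have [l2 [h2 H2]] := H (bv false) av; have [l3 [h3 H3]] := H (bv true) av.
exists (fun k => nth 0 [:: l0; l1; l2; l3] k), (fun k => nth 0 [:: h0; h1; h2; h3] k).
apply/seteqP; split => E /=.
  move=> [i [j Eij]].
  have [le|/ltW le] := leP `|E - av i| `|E - bv j|.
  - have {le} : near_band (av i) (bv j) E by [].
    case: i {Eij} => nb.
      by exists (inord 1) => //=; rewrite inordK//= in_itv/=; apply/H1; case: j nb; [right|left].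
    by exists (inord 0) => //=; rewrite inordK//= in_itv/=; apply/H0; case: j nb; [right|left].
  - have {le} : near_band (bv j) (av i) E by split; rewrite // mulrC.
    case: j {Eij} => nb.
      by exists (inord 3) => //=; rewrite inordK//= in_itv/=; apply/H3; case: i nb; [right|left].
    by exists (inord 2) => //=; rewrite inordK//= in_itv/=; apply/H2; case: i nb; [right|left].
move=> [[k kP] _] /=; rewrite in_itv/=.
case: k kP => [|[|[|[|//]]]] _ /=.
- by move=> /H0[[]|[]]; [exists false, false|exists false, true].
- by move=> /H1[[]|[]]; [exists true, false|exists true, true].
- by move=> /H2[[]|[]]; rewrite mulrC; [exists false, false|exists true, false].
- by move=> /H3[[]|[]]; rewrite mulrC; [exists false, true|exists true, true].
Qed.

(** What [D_ge] and [D_edge] ask of an edge whose ends carry the values [x] and [y] of [V - E]. *)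
Definition gap (delta x y : R) : Prop :=
  [/\ delta <= `|x|, delta <= `|y| & 0 < x * y -> 4 <= (`|x| - delta) * (`|y| - delta)].

Lemma gap_le delta delta' x y : delta' <= delta -> gap delta x y -> gap delta' x y.
Proof.
move=> le [dx dy h]; split; [exact: le_trans dx|exact: le_trans dy|] => /h{}h.
by apply: le_trans h _; apply: ler_pM; rewrite ?subr_ge0// lerB.
Qed.

Lemma gap_exists x y : ~ (0 <= x * y <= 4) -> exists2 delta, 0 < delta & gap delta x y.
Proof.
move=> /negP; rewrite negb_and -!ltNge => /orP[xy|xy].
  exists (Num.min `|x| `|y|); last first.
    by split; rewrite ?ge_min ?lexx ?orbT// => xy'; have := lt_trans xy xy'; rewrite ltxx.
  rewrite lt_min !normr_gt0.
  by apply/andP; split; apply/eqP => e; move: xy; rewrite e ?mul0r ?mulr0 ltxx.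
have xy0 : 0 < x * y by apply: lt_trans xy.
move: (xy); rewrite -(gtr0_norm xy0) normrM => {}xy.
have x0 : 0 < `|x| by rewrite normr_gt0; apply/eqP => e; move: xy0; rewrite e mul0r ltxx.
have y0 : 0 < `|y| by rewrite normr_gt0; apply/eqP => e; move: xy0; rewrite e mulr0 ltxx.
rewrite /gap; move: `|x| `|y| x0 y0 xy => p q p0 q0 pq.
have pq0 : 0 < p + q by rewrite addr_gt0.
(* With this choice [(p - delta) * (q - delta) = 4 + delta ^+ 2]. *)
pose delta := (p * q - 4) / (p + q).
have dE : delta * (p + q) = p * q - 4 by rewrite /delta divfK// gt_eqF.
have d0 : 0 < delta by rewrite divr_gt0// subr_gt0.
exists delta => //; split=> [||_]; nra.
Qed.

Lemma off_bands_bounded_inverse (av bv : bool -> R) (V : int -> R) E :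
  (forall n : int, exists i, V n = if (2 %| n)%Z then av i else bv i) ->
  ~ bands av bv E -> has_bounded_inverse V E.
Proof.
move=> Vab nE.
have gij i j : exists2 delta, 0 < delta & gap delta (av i - E) (bv j - E).
  apply: gap_exists => h; apply: nE; exists i, j.
  by rewrite -(opprB _ E) -(opprB (bv j)) mulrNN.
(* There are only four pairs of values, and [gap] persists when [delta] shrinks, so the minimum
   serves all. *)
have [delta delta0 gd] : exists2 delta, 0 < delta &
    forall i j, gap delta (av i - E) (bv j - E).
  have [d1 p1 g1] := gij true true; have [d2 p2 g2] := gij true false.
  have [d3 p3 g3] := gij false true; have [d4 p4 g4] := gij false false.
  exists (Num.min (Num.min d1 d2) (Num.min d3 d4)); first by rewrite !lt_min p1 p2 p3.
  move=> [] []; [move: g1|move: g2|move: g3|move: g4]; apply: gap_le;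
    by rewrite !ge_min lexx ?orbT.
pose K := 1 + (`|av true - E| + `|av false - E| + `|bv true - E| + `|bv false - E|).
apply: (@coercive_bounded_inverse _ V E delta K) => //.
- move=> n; have [i ->] := Vab n.
  by case: ifP => _; [case: (gd i i)|case: (gd i i)].
- by rewrite lerDl !addr_ge0.
- move=> n; have [i ->] := Vab n; rewrite /K.
  have := normr_ge0 (av true - E); have := normr_ge0 (av false - E).
  have := normr_ge0 (bv true - E); have := normr_ge0 (bv false - E).
  by case: ifP => _; case: i; lra.
- move=> n; have [i ->] := Vab n; have [j ->] := Vab (n + 1).
  have -> : (2 %| n + 1)%Z = ~~ (2 %| n)%Z by lia.
  case: ifP => _ /=; first by case: (gd i j).
  by rewrite mulrC [X in _ -> _ <= X]mulrC; case: (gd j i).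
Qed.

End Bands.

(** * The almost sure spectrum *)

Unset Implicit Arguments. Set Strict Implicit.

Theorem theorem1 (R : realType) (lam0 lam1 c0 c1 p0 p1 : R)
  (hp0 : 0 < p0 < 1) (hp1 : 0 < p1 < 1)
  (d : measure_display) (T : measurableType d) (P : probability T R)
  (xi : int -> T -> R) (V : int -> T -> R)
  (xi_meas : forall n, measurable_fun [set: T] (xi n))
  (xi_bern : forall n,
     P (xi n @^-1` [set 1]) = (if (2 %| n)%Z then p0 else p1)%:E /\
     P (xi n @^-1` [set 0]) = (if (2 %| n)%Z then 1 - p0 else 1 - p1)%:E)
  (V_def : forall n w,
     V n w = if (2 %| n)%Z then lam0 * xi n w + c0 else lam1 * xi n w + c1)
  (V_indep : independent_rvs P V) :
  exists S : set R,
    {ae P, forall w, spectrum (fun n => V n w) = S} /\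
    exists a b : 'I_4 -> R, S = \bigcup_(i in [set: 'I_4]) `[a i, b i]%classic.
Proof.
pose av (i : bool) := lam0 * i%:R + c0.
pose bv (i : bool) := lam1 * i%:R + c1.
exists (bands av bv); split; last exact: bands_four_itv.
have mxi n x : measurable (xi n @^-1` [set x]).
  by rewrite -[X in measurable X]setTI; apply: xi_meas.
have V_meas n : measurable_fun [set: T] (V n).
  rewrite (_ : V n = fun w => if (2 %| n)%Z then lam0 * xi n w + c0 else lam1 * xi n w + c1);
    last by apply/funext => w; exact: V_def.
  by case: (2 %| n)%Z; apply: measurable_funD => //; apply: measurable_funM.
have aeP : Filter (nbhs (almost_everywhere P)) by exact: ae_filter_ringOfSetsType.
(* At each site the atoms 0 and 1 carry total mass 1, and there are countably many sites. *)
have ae_values : {ae P, forall w, forall n, xi n w = 0 \/ xi n w = 1}.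
  have one n : {ae P, forall w, xi n w = 0 \/ xi n w = 1}.
    exists (~` (xi n @^-1` [set 0] `|` xi n @^-1` [set 1])); split.
    - by apply: measurableC; exact: measurableU.
    - have PU : P (xi n @^-1` [set 0%R] `|` xi n @^-1` [set 1%R]) =
          (P (xi n @^-1` [set 0%R]) + P (xi n @^-1` [set 1%R]))%E.
        apply: measureU => //.
        by rewrite -subset0 => w [/= -> /eqP]; rewrite eq_sym oner_eq0.
      rewrite probability_setC; last exact: measurableU.
      have [H1 H0] := xi_bern n; rewrite PU H1 H0.
      by case: ifP => _; rewrite -EFinD subrK subrr.
    - by [].
  have ae_nat := @ae_foralln _ _ _ P
    (fun k w => (xi k%:Z w = 0 \/ xi k%:Z w = 1) /\ (xi (- k%:Z) w = 0 \/ xi (- k%:Z) w = 1))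
    (fun k => @filterI _ _ aeP _ _ (one k%:Z) (one (- k%:Z))).
  apply: filterS ae_nat => w H [k|k]; first exact: (H k).1.
  by rewrite NegzE; exact: (H k.+1).2.
(* A lower bound for all atom probabilities, uniform over sites and patterns. *)
pose pi0 := Num.min (Num.min p0 (1 - p0)) (Num.min p1 (1 - p1)).
have pi0_gt0 : 0 < pi0.
  by move/andP: hp0 => [? ?]; move/andP: hp1 => [? ?]; rewrite !lt_min !subr_gt0; apply/andP; split; apply/andP.
pose pat i j (n : int) := if (2 %| n)%Z then av i else bv j.
have pat_ge i j n : (pi0%:E <= P (V n @^-1` [set pat i j n]))%E.
  pose k := if (2 %| n)%Z then i else j.
  have : (pi0%:E <= P (xi n @^-1` [set k%:R]))%E.
    have [H1 H0] := xi_bern n.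
    have : pi0 <= p0 /\ pi0 <= 1 - p0 /\ pi0 <= p1 /\ pi0 <= 1 - p1.
      by rewrite /pi0 !ge_min !lexx ?orbT.
    move=> [? [? [? ?]]].
    by case: k; rewrite /= ?H1 ?H0 lee_fin; case: ifP.
  move=> /le_trans; apply.
  (* Inclusion of events is all one can claim: if [lam0] or [lam1] is 0, distinct values of [xi n]
     give the same [V n]. *)
  apply: le_measure; [exact: mem_set|apply: mem_set|].
    by rewrite -[X in measurable X]setTI; apply: V_meas.
  by move=> w /= wk; rewrite V_def wk /pat /k; case: (2 %| n)%Z.
have ae_pat i j : {ae P, forall w, forall N : nat, exists k,
    cylinder V (pat i j) (block N.*2 k) w}.
  by apply: ae_foralln => N; apply: (ae_some_block V_meas V_indep pi0_gt0 (pat_ge i j)).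
have ae_pats := @filterI _ _ aeP _ _
  (@filterI _ _ aeP _ _ (ae_pat true true) (ae_pat true false))
  (@filterI _ _ aeP _ _ (ae_pat false true) (ae_pat false false)).
apply: filterS2 ae_values ae_pats => w vals pats.
apply/seteqP; split => E.
  apply: contra_notP => nE; apply: off_bands_bounded_inverse nE => n.
  rewrite V_def /av /bv; case: (vals n) => ->; [exists false|exists true]; by case: ifP.
move=> [i [j Eij]]; apply: (long_stretches_spectrum Eij) => N.
have [k /cylinderP H] : exists k, cylinder V (pat i j) (block N.*2 k) w.
  by case: pats => [[tt tf] [ft ff]]; case: i {Eij}; case: j.
exists (N.*2 * k)%N%:Z => n nN; apply: H.
by apply/mapP; exists (`|n - (N.*2 * k)%N%:Z|)%N; rewrite ?mem_iota; lia.
Qed.
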